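(* For every rational number $j/k \in (0,1]$ (with $j,k$ positive coprime integers) there exists a periodic solution of Hamilton's equations for the Kepler–Heisenberg Hamiltonian with rotation number $j/k$: if $T$ is its period, then after time $T/k$ the planet has rotated by angle $2\pi j/k$ counterclockwise about the $z$-axis, i.e. $(x(t+T/k), y(t+T/k))$ is the rotation of $(x(t),y(t))$ by angle $2\pi j/k$ for all $t$.
   Context: Phase space is $T^*\mathbb R^3$ with coordinates $(x,y,z,p_x,p_y,p_z)$. Set $P_X = p_x - \tfrac12 y p_z$, $P_Y = p_y + \tfrac12 x p_z$. The Kepler–Heisenberg Hamiltonian is $H = \tfrac12(P_X^2 + P_Y^2) - \frac{1}{8\pi\sqrt{(x^2+y^2)^2+16z^2}}$, defined away from $x=y=z=0$ (collision). A periodic solution is a collision-free solution defined for all $t\in\mathbb R$ with $c(t+T)=c(t)$ for some $T>0$. *)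

(* Defs.v *)
From Stdlib Require Import Reals Lra.
From Coquelicot Require Import Coquelicot.
Open Scope R_scope.

Definition PX (x y z px py pz : R) : R := px - / 2 * y * pz.
Definition PY (x y z px py pz : R) : R := py + / 2 * x * pz.

(* Kepler–Heisenberg Hamiltonian (meaningful away from x=y=z=0). *)
Definition KH (x y z px py pz : R) : R :=
  / 2 * ((PX x y z px py pz) ^ 2 + (PY x y z px py pz) ^ 2)
  - / (8 * PI * sqrt ((x ^ 2 + y ^ 2) ^ 2 + 16 * z ^ 2)).

Record phase_curve := PC {
  cx : R -> R; cy : R -> R; cz : R -> R;
  cpx : R -> R; cpy : R -> R; cpz : R -> R }.

Definition collision_free (c : phase_curve) : Prop :=
  forall t, ~ (cx c t = 0 /\ cy c t = 0 /\ cz c t = 0).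

Definition hamilton_solution (c : phase_curve) : Prop :=
  forall t,
  let x := cx c t in let y := cy c t in let z := cz c t in
  let px := cpx c t in let py := cpy c t in let pz := cpz c t in
  is_derive (cx c) t (Derive (fun s => KH x y z s py pz) px) /\
  is_derive (cy c) t (Derive (fun s => KH x y z px s pz) py) /\
  is_derive (cz c) t (Derive (fun s => KH x y z px py s) pz) /\
  is_derive (cpx c) t (- Derive (fun s => KH s y z px py pz) x) /\
  is_derive (cpy c) t (- Derive (fun s => KH x s z px py pz) y) /\
  is_derive (cpz c) t (- Derive (fun s => KH x y s px py pz) z).

Definition has_period (c : phase_curve) (T : R) : Prop :=
  forall t,
    cx c (t + T) = cx c t /\ cy c (t + T) = cy c t /\ cz c (t + T) = cz c t /\
    cpx c (t + T) = cpx c t /\ cpy c (t + T) = cpy c t /\ cpz c (t + T) = cpz c t.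

Definition minimal_period (c : phase_curve) (T : R) : Prop :=
  0 < T /\ has_period c T /\ forall T', 0 < T' < T -> ~ has_period c T'.

Definition periodic_solution (c : phase_curve) (T : R) : Prop :=
  hamilton_solution c /\ collision_free c /\ minimal_period c T.

Definition rotation_number (c : phase_curve) (T : R) (j k : nat) : Prop :=
  let th := 2 * PI * INR j / INR k in
  forall t,
    cx c (t + T / INR k) = cos th * cx c t - sin th * cy c t /\
    cy c (t + T / INR k) = sin th * cx c t + cos th * cy c t.

(* Main.v *)
Require Import Defs.
From Stdlib Require Import Reals Arith ZArith Lra Lia.
From Coquelicot Require Import Coquelicot.
Open Scope R_scope.

(* The system is integrable on the level where the energy [H] and the dilation
   momentum [J = x px + y py + 2 z pz] both vanish. In the reduced phase space
   every orbit with angular momentum [m = 1 / (2 l sqrt PI)] oscillates, along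
   the curve where [r ^ 2] is a quadratic function of
   [rho = sqrt (r ^ 4 + 16 z ^ 2)], and [rho = l ^ 2 + 2 + 2 l cos s]
   parametrizes the oscillation smoothly. During one oscillation the planet
   turns by an angle [total_twist l], an elliptic integral that is continuous
   in [l], zero at [l = 0] and positive for [l = 1], so every small positive
   angle occurs. To get rotation number [j / k], choose [n] coprime to [j] and
   large enough that the angle [2 PI j / (k n)] occurs: [n] oscillations turn
   the planet by [2 PI j / k], and as [j] is coprime to [k n] the motion closes
   up after exactly [k n] oscillations. *)

(** * The solutions in reduced coordinates *)

(** Naming the square root [rho] makes every partial derivative a rational expression, so that later
    verifications reduce to [field]. *)
Lemma KH_gradient (x y z px py pz rho : R) :
  0 < rho -> (x ^ 2 + y ^ 2) ^ 2 + 16 * z ^ 2 = rho ^ 2 ->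
  Derive (fun s => KH x y z s py pz) px = PX x y z px py pz /\
  Derive (fun s => KH x y z px s pz) py = PY x y z px py pz /\
  Derive (fun s => KH x y z px py s) pz =
    / 2 * (x * PY x y z px py pz - y * PX x y z px py pz) /\
  Derive (fun s => KH s y z px py pz) x =
    / 2 * pz * PY x y z px py pz + (x ^ 2 + y ^ 2) * x / (4 * PI * rho ^ 3) /\
  Derive (fun s => KH x s z px py pz) y =
    - (/ 2 * pz * PX x y z px py pz) + (x ^ 2 + y ^ 2) * y / (4 * PI * rho ^ 3) /\
  Derive (fun s => KH x y s px py pz) z = 2 * z / (PI * rho ^ 3).
Proof.
intros Hrho E; pose proof PI_RGT_0.
assert (Hs : sqrt ((x ^ 2 + y ^ 2) ^ 2 + 16 * z ^ 2) = rho)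
  by (rewrite E; apply sqrt_pow2; lra).
assert (Hp : 0 < (x ^ 2 + y ^ 2) ^ 2 + 16 * z ^ 2) by (rewrite E; apply pow_lt, Hrho).
unfold KH, PX, PY.
repeat split; apply is_derive_unique; auto_derive;
  change (x * (x * 1)) with (x ^ 2) in *; change (y * (y * 1)) with (y ^ 2) in *;
  change (z * (z * 1)) with (z ^ 2) in *;
  change ((x ^ 2 + y ^ 2) * ((x ^ 2 + y ^ 2) * 1)) with ((x ^ 2 + y ^ 2) ^ 2);
  rewrite ?Hs; auto; try (repeat split; auto; nra); field; lra.
Qed.

(* On [H = J = 0], with angular momentum [m] and the scale fixed, [r ^ 2] is the
   quadratic function [rad l] of [rho = sqrt (r ^ 4 + 16 z ^ 2)]; [rad_slope] is
   its derivative. *)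
Definition rad_slope (l rho : R) : R := (rho - l ^ 2) / 2.
Definition rad (l rho : R) : R := rad_slope l rho ^ 2 + 1.

Lemma rad_pos (l rho : R) : 0 < rad l rho.
Proof. unfold rad; pose proof (pow2_ge_0 (rad_slope l rho)); lra. Qed.

(* [rp] is [r] times the radial momentum. *)
Definition reduced_curve (l m : R) (rho x y z : R -> R) : phase_curve :=
  let rp t := 4 * m * rad_slope l (rho t) * z t / rho t in
  PC x y z
    (fun t => (rp t * x t - m * y t) / rad l (rho t))
    (fun t => (rp t * y t + m * x t) / rad l (rho t))
    (fun t => m * (l ^ 2 / rho t - 1)).

(* The coefficient of [x] in the equation for [cpx], and of [y] in that for [cpy]. *)
Lemma radial_balance (e m r z h G : R) :
  0 < r -> h = (r - e) / 2 -> G = h ^ 2 + 1 -> G ^ 2 + 16 * z ^ 2 = r ^ 2 ->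
  4 * m * (4 * m * z ^ 2 / r ^ 2 + h * (m / 2 * (1 - G * h / r)) / r - 8 * m * h * z ^ 2 / r ^ 3) / G
    - 16 * m ^ 2 * h ^ 2 * z ^ 2 / r ^ 2 / G ^ 2 - m ^ 2 * (/ G - h / r) / G
  = m ^ 2 * h * (/ G - h / r) / r - e * m ^ 2 * G / r ^ 3.
Proof.
intros Hr Eh EG Ez.
assert (HG : 0 < G) by (pose proof (pow2_ge_0 h); lra).
replace (z ^ 2) with ((r ^ 2 - G ^ 2) / 16) by lra.
replace e with (r - 2 * h) by lra.
rewrite EG in HG |- *; field; lra.
Qed.

(** The prescribed derivatives of [x] and [y] are [PX] and [PY]. The condition on [l] and [m]
    expresses zero energy: along the curve [PX ^ 2 + PY ^ 2] equals [l ^ 2 * m ^ 2 / rho]. It also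
    trades [/ PI] for [4 * l ^ 2 * m ^ 2]. *)
Lemma reduced_curve_solution (l m : R) (rho x y z : R -> R) :
  4 * PI * l ^ 2 * m ^ 2 = 1 ->
  (forall t, 0 < rho t) ->
  (forall t, x t ^ 2 + y t ^ 2 = rad l (rho t)) ->
  (forall t, rad l (rho t) ^ 2 + 16 * z t ^ 2 = rho t ^ 2) ->
  (forall t, is_derive rho t (8 * m * z t / rho t)) ->
  (forall t, is_derive z t (m / 2 * (1 - rad l (rho t) * rad_slope l (rho t) / rho t))) ->
  (forall t, is_derive x t
     (4 * m * rad_slope l (rho t) * z t / rho t * x t / rad l (rho t)
      - m * (/ rad l (rho t) - rad_slope l (rho t) / rho t) * y t)) ->
  (forall t, is_derive y t
     (4 * m * rad_slope l (rho t) * z t / rho t * y t / rad l (rho t)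
      + m * (/ rad l (rho t) - rad_slope l (rho t) / rho t) * x t)) ->
  hamilton_solution (reduced_curve l m rho x y z).
Proof.
intros Hm Hrho Hr Hz Drho Dz Dx Dy t; cbn -[pow].
specialize (Hrho t); specialize (Hr t); specialize (Hz t).
specialize (Drho t); specialize (Dz t); specialize (Dx t); specialize (Dy t).
destruct (KH_gradient (x t) (y t) (z t)
  ((4 * m * rad_slope l (rho t) * z t / rho t * x t - m * y t) / rad l (rho t))
  ((4 * m * rad_slope l (rho t) * z t / rho t * y t + m * x t) / rad l (rho t))
  (m * (l ^ 2 / rho t - 1)) (rho t) Hrho) as (-> & -> & -> & -> & -> & ->);
  [rewrite Hr; exact Hz|].
assert (HG := rad_pos l (rho t)).
assert (Erho : Derive (fun s : R => rho s) t = 8 * m * z t / rho t)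
  by (apply is_derive_unique, Drho).
assert (Ez : Derive (fun s : R => z s) t =
    m / 2 * (1 - rad l (rho t) * rad_slope l (rho t) / rho t))
  by (apply is_derive_unique, Dz).
assert (DG : is_derive (fun t => rad l (rho t)) t
    (8 * m * rad_slope l (rho t) * z t / rho t)).
{ unfold rad, rad_slope; auto_derive; [eexists; exact Drho|].
  rewrite Erho; field; lra. }
assert (DP : is_derive (fun t => 4 * m * rad_slope l (rho t) * z t / rho t) t
  (4 * m * (4 * m * z t ^ 2 / rho t ^ 2
    + rad_slope l (rho t) * (m / 2 * (1 - rad l (rho t) * rad_slope l (rho t) / rho t)) / rho t
    - 8 * m * rad_slope l (rho t) * z t ^ 2 / rho t ^ 3))).
{ set (G := rad l (rho t)) in *; unfold rad_slope in *.
  auto_derive; [repeat split; (lra || (eexists; eassumption))|].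
  rewrite Erho, Ez; field; lra. }
assert (Epi : / PI = 4 * l ^ 2 * m ^ 2)
  by (pose proof PI_RGT_0; apply (Rmult_eq_reg_l PI); [rewrite Rinv_r|]; lra).
assert (Epi' : forall u, rad l (rho t) * u / (4 * PI * rho t ^ 3) =
  l ^ 2 * m ^ 2 * rad l (rho t) * u / rho t ^ 3).
{ pose proof PI_RGT_0; intros u.
  replace (rad l (rho t) * u / (4 * PI * rho t ^ 3))
    with (rad l (rho t) * u / (4 * rho t ^ 3) * / PI) by (field; lra).
  rewrite Epi; field; lra. }
(* [RB] is the right-hand side of [radial_balance] at [e = l ^ 2]. Each horizontal force is [RB]
   times its own coordinate plus a multiple of the other one, so a single scalar identity settles
   both equations. *)
set (RB := m ^ 2 * rad_slope l (rho t) * (/ rad l (rho t) - rad_slope l (rho t) / rho t) / rho t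
  - l ^ 2 * m ^ 2 * rad l (rho t) / rho t ^ 3).
pose proof PI_RGT_0.
unfold PX, PY.
assert (Hpz : l ^ 2 / rho t - 1 = - 2 * rad_slope l (rho t) / rho t)
  by (unfold rad_slope; field; lra).
rewrite Hpz.
split; [|split; [|split; [|split; [|split]]]].
- evar_last; [exact Dx|].
  field; lra.
- evar_last; [exact Dy|].
  field; lra.
- evar_last; [exact Dz|].
  transitivity (m / 2 * ((x t ^ 2 + y t ^ 2) / rad l (rho t)
    - (x t ^ 2 + y t ^ 2) * rad_slope l (rho t) / rho t)).
  + rewrite Hr; field; lra.
  + field; lra.
- evar_last.
  { apply (is_derive_div (fun t => 4 * m * rad_slope l (rho t) * z t / rho t * x t - m * y t)
      (fun t => rad l (rho t))); [|exact DG|lra].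
    apply @is_derive_minus; [|apply is_derive_scal, Dy].
    apply @is_derive_mult; [exact DP|exact Dx|intros; apply Rmult_comm]. }
  unfold minus, plus, opp, mult; cbn -[pow].
  rewrite Hr, Epi'.
  transitivity (- (/ 2 * (m * (-2 * rad_slope l (rho t) / rho t))
    * (4 * m * rad_slope l (rho t) * z t / rho t * y t / rad l (rho t)) + x t * - RB)).
  2:{ unfold RB; field; lra. }
  unfold RB.
  rewrite <- (radial_balance (l ^ 2) m (rho t) (z t) (rad_slope l (rho t)) (rad l (rho t)))
    by (assumption || reflexivity).
  field; lra.
- evar_last.
  { apply (is_derive_div (fun t => 4 * m * rad_slope l (rho t) * z t / rho t * y t + m * x t)
      (fun t => rad l (rho t))); [|exact DG|lra].
    apply @is_derive_plus; [|apply is_derive_scal, Dx].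
    apply @is_derive_mult; [exact DP|exact Dy|intros; apply Rmult_comm]. }
  unfold minus, plus, opp, mult; cbn -[pow].
  rewrite Hr, Epi'.
  transitivity (- (- (/ 2 * (m * (-2 * rad_slope l (rho t) / rho t))
    * (4 * m * rad_slope l (rho t) * z t / rho t * x t / rad l (rho t))) + y t * - RB)).
  2:{ unfold RB; field; lra. }
  unfold RB.
  rewrite <- (radial_balance (l ^ 2) m (rho t) (z t) (rad_slope l (rho t)) (rad l (rho t)))
    by (assumption || reflexivity).
  field; lra.
- evar_last.
  { apply (is_derive_ext (fun t => m * l ^ 2 * / rho t - m));
      [intros u; match goal with |- ?a = ?b => change (@eq R a b) end; unfold Rdiv; ring|].
    apply @is_derive_minus; [|apply @is_derive_const].
    apply is_derive_scal, is_derive_inv; [exact Drho|lra]. }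
  unfold minus, plus, opp, mult, zero; cbn -[pow].
  replace (2 * z t / (PI * rho t ^ 3)) with (2 * z t / rho t ^ 3 * / PI) by (field; lra).
  rewrite Epi; field; lra.
Qed.

(** * Calculus *)

Lemma derive_ge_increment (F f : R -> R) (delta a b : R) :
  (forall s, is_derive F s (f s)) -> (forall s, delta <= f s) -> a <= b ->
  delta * (b - a) <= F b - F a.
Proof.
intros DF Hf Hab.
destruct (MVT_gen F a b f) as (c & _ & ->).
- intros; apply DF.
- intros x _; apply continuity_pt_filterlim, (ex_derive_continuous F); eexists; apply DF.
- apply Rmult_le_compat_r; [lra|apply Hf].
Qed.

(** Expansion by [delta] makes [F] injective and unbounded both ways, hence onto by the intermediate
    value theorem, and it makes the inverse Lipschitz, so that difference quotients can be inverted.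
    This serves to express the oscillation parameter through time. *)
Lemma inverse_of_expanding (F f : R -> R) (delta : R) :
  0 < delta -> (forall s, is_derive F s (f s)) -> (forall s, delta <= f s) ->
  {G : R -> R | (forall t, F (G t) = t) /\ (forall s, G (F s) = s) /\
    forall t, is_derive G t (/ f (G t))}.
Proof.
intros Hd DF Hf.
pose proof (fun a b => derive_ge_increment F f delta a b DF Hf) as Hinc.
assert (Hc : forall s, continuous F s) by (intros s; apply (ex_derive_continuous F); eexists; apply DF).
assert (Hdist : forall a b, delta * Rabs (b - a) <= Rabs (F b - F a)).
{ intros a b; destruct (Rle_lt_dec a b) as [H|H].
  - specialize (Hinc a b H); rewrite !Rabs_pos_eq; nra.
  - specialize (Hinc b a (Rlt_le _ _ H)).
    rewrite (Rabs_minus_sym b), (Rabs_minus_sym (F b)), !Rabs_pos_eq; nra. }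
assert (Hsurj : forall t, {s | F s = t}).
{ intros t; set (u := Rabs (t - F 0) / delta).
  assert (Hu : delta * u = Rabs (t - F 0)) by (unfold u; field; lra).
  assert (Hu0 : 0 <= u) by (apply Rdiv_le_0_compat; [apply Rabs_pos|exact Hd]).
  pose proof (Rle_abs (t - F 0)); pose proof (Rle_abs (- (t - F 0))).
  rewrite Rabs_Ropp in *.
  assert (H1 := Hinc 0 u Hu0).
  assert (H2 : delta * (0 - - u) <= F 0 - F (- u)) by (apply Hinc; lra).
  destruct (IVT_gen_consistent F (- u) u t Hc) as (s & _ & Hs); [|exists s; exact Hs].
  rewrite Rmin_left, Rmax_right by lra; lra. }
set (G t := proj1_sig (Hsurj t)).
assert (FG : forall t, F (G t) = t) by (intros t; apply (proj2_sig (Hsurj t))).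
exists G; split; [exact FG|split].
- intros s; specialize (Hdist s (G (F s))); rewrite FG, Rminus_diag, Rabs_R0 in Hdist.
  pose proof (Rabs_pos (G (F s) - s)).
  destruct (Req_dec (G (F s)) s) as [|Hn]; [assumption|].
  assert (0 < Rabs (G (F s) - s)) by (apply Rabs_pos_lt; lra); nra.
- intros t; apply is_derive_Reals; intros eps Heps.
  assert (Hfp : 0 < f (G t)) by (specialize (Hf (G t)); lra).
  (* With [k] the increment of [G] over [h], the error of [k / h] is that of [h / k] times
     [k / h / f (G t)], and [Rabs (k / h)] is at most [/ delta]; hence this tolerance. Likewise
     [Rabs h < delta * eta] forces [Rabs k < eta]. *)
  pose proof (proj1 (is_derive_Reals _ _ _) (DF (G t)) (eps * delta * f (G t))) as [eta Heta].
  { repeat apply Rmult_lt_0_compat; lra. }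
  assert (Hp : 0 < delta * eta) by (apply Rmult_lt_0_compat; [lra|apply cond_pos]).
  exists (mkposreal _ Hp); cbn; intros h Hh0 Hh.
  set (k := G (t + h) - G t).
  assert (EF : F (G t + k) - F (G t) = h)
    by (unfold k; replace (G t + (G (t + h) - G t)) with (G (t + h)) by ring; rewrite !FG; ring).
  assert (Hk0 : k <> 0) by (intros E; apply Hh0; rewrite <- EF, E, Rplus_0_r; ring).
  assert (Hk : delta * Rabs k <= Rabs h).
  { specialize (Hdist (G t) (G t + k)); rewrite EF in Hdist.
    replace (G t + k - G t) with k in Hdist by ring; exact Hdist. }
  specialize (Heta k Hk0 ltac:(nra)); rewrite EF in Heta.
  assert (Hk' : 0 < Rabs k) by (apply Rabs_pos_lt, Hk0).
  assert (Hh' : 0 < Rabs h) by (apply Rabs_pos_lt, Hh0).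
  replace (k / h - / f (G t)) with (- (h / k - f (G t)) * (k / h / f (G t))) by (field; lra).
  rewrite Rabs_mult, Rabs_Ropp.
  replace (Rabs (k / h / f (G t))) with (Rabs k / Rabs h / f (G t))
    by (unfold Rdiv; rewrite !Rabs_mult, !Rabs_inv, (Rabs_pos_eq (f _)); lra).
  apply Rlt_le_trans with (eps * delta * f (G t) * (Rabs k / Rabs h / f (G t))).
  + apply Rmult_lt_compat_r; [|exact Heta].
    repeat apply Rdiv_lt_0_compat; assumption.
  + replace (eps * delta * f (G t) * (Rabs k / Rabs h / f (G t)))
      with (eps * (delta * Rabs k) / Rabs h) by (field; lra).
    apply Rle_div_l; [lra|]; nra.
Qed.

Lemma continuous_ex_RInt (f : R -> R) (a b : R) :
  (forall s, continuous f s) -> ex_RInt f a b.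
Proof. intros Hf; apply (ex_RInt_continuous f); intros; apply Hf. Qed.

Lemma is_derive_primitive (f : R -> R) (a s : R) :
  (forall u, continuous f u) -> is_derive (fun v => RInt f a v) s (f s).
Proof.
intros Hf; apply (is_derive_RInt f _ a); [|apply Hf].
apply filter_forall; intros b; apply (RInt_correct f), continuous_ex_RInt, Hf.
Qed.

Lemma RInt_periodic (f : R -> R) (T s : R) (n : nat) :
  (forall u, continuous f u) -> (forall u, f (u + T) = f u) ->
  RInt f 0 (s + INR n * T) = RInt f 0 s + INR n * RInt f 0 T.
Proof.
intros Hc Hper.
assert (Hex := fun a b => continuous_ex_RInt f a b Hc).
assert (Hstep : forall s, RInt f 0 (s + T) = RInt f 0 s + RInt f 0 T).
{ intros u; rewrite <- (RInt_Chasles f 0 T (u + T)) by apply Hex.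
  rewrite Rplus_comm.
  replace (RInt f T (u + T)) with (RInt f 0 u); [reflexivity|].
  pose proof (RInt_comp_lin f 1 T 0 u (Hex _ _)) as E.
  rewrite Rmult_0_r, Rplus_0_l, Rmult_1_l in E; rewrite <- E.
  apply RInt_ext; intros v _; change (f v = 1 * f (1 * v + T)); rewrite !Rmult_1_l, Hper; reflexivity. }
induction n as [|n IH].
- cbn; rewrite !Rmult_0_l, !Rplus_0_r; reflexivity.
- rewrite S_INR.
  replace (s + (INR n + 1) * T) with (s + INR n * T + T) by ring.
  rewrite Hstep, IH.
  match goal with |- ?a = ?b => change (@eq R a b) end; ring.
Qed.

Lemma continuity_2d_pt_continuous (f : R -> R -> R) (x y : R) :
  continuity_2d_pt f x y -> continuous (f x) y.
Proof.
intros Hf; apply continuity_pt_filterlim; intros eps Heps.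
destruct (Hf (mkposreal eps Heps)) as [d Hd].
exists d; split; [apply cond_pos|]; intros v (_ & Hv).
apply (Hd x v); [rewrite Rminus_diag, Rabs_R0; apply cond_pos|exact Hv].
Qed.

(** Uniform continuity of [f] along the compact segment over [x] makes nearby integrands uniformly
    close. *)
Lemma continuous_RInt_param (f : R -> R -> R) (a b : R) :
  a <= b -> (forall x y, continuity_2d_pt f x y) ->
  forall x, continuous (fun u => RInt (f u) a b) x.
Proof.
intros Hab Hf x.
assert (Hex : forall u, ex_RInt (f u) a b).
{ intros u; apply continuous_ex_RInt; intros s; apply continuity_2d_pt_continuous, Hf. }
apply continuity_pt_filterlim; intros eps Heps.
(* The [+ 1] keeps the denominator positive when [a = b]. *)
assert (He : 0 < eps / (2 * (b - a + 1))) by (apply Rdiv_lt_0_compat; lra).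
destruct (uniform_continuity_2d_1d' f a b x (fun y _ => Hf x y) (mkposreal _ He)) as [d Hd].
exists d; split; [apply cond_pos|]; intros u (_ & Hu); change (Rabs (u - x) < d) in Hu.
change (Rabs (RInt (f u) a b - RInt (f x) a b) < eps).
replace (RInt (f u) a b - RInt (f x) a b) with (RInt (fun s => f u s - f x s) a b)
  by (apply (RInt_minus (f u) (f x)); apply Hex).
apply Rle_lt_trans with ((b - a) * (eps / (2 * (b - a + 1)))).
- apply abs_RInt_le_const; [exact Hab|apply (ex_RInt_minus (f u) (f x)); apply Hex|].
  intros s Hs; left; apply Rabs_lt_between' in Hu.
  apply (Hd s x s u); try lra; [split; lra..|]; rewrite Rminus_diag, Rabs_R0; apply cond_pos.
- apply Rlt_le_trans with ((b - a + 1) * (eps / (2 * (b - a + 1)))).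
  + apply Rmult_lt_compat_r; lra.
  + replace ((b - a + 1) * (eps / (2 * (b - a + 1)))) with (eps / 2) by (field; lra); lra.
Qed.

Lemma cos_eq_1_nat (x : R) : 0 <= x -> cos x = 1 -> exists q : nat, x = INR q * (2 * PI).
Proof.
intros Hx Hcos; pose proof PI_RGT_0.
assert (Hs : sin (x / 2) = 0).
{ replace x with (2 * (x / 2)) in Hcos by field; rewrite cos_2a_sin in Hcos; nra. }
apply sin_eq_0_0 in Hs as (k & Hk).
assert (Hk0 : (0 <= k)%Z) by (apply le_IZR; nra).
exists (Z.to_nat k); rewrite INR_IZR_INZ, Z2Nat.id by exact Hk0; lra.
Qed.

(** * The oscillation of the reduced orbit *)

(* The reduced orbit, parametrized by an angle [s]: [level] is
   [rho = sqrt (r ^ 4 + 16 z ^ 2)], [height] is [z], [clock_rate] is [dt/ds].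
   The radicand in [width] is [rho + r ^ 2]; since
   [rho - r ^ 2 = l ^ 2 sin ^ 2 s], [height] is a square root of
   [(rho ^ 2 - r ^ 4) / 16] that is smooth through its zeros. *)
Definition level (l s : R) : R := l ^ 2 + 2 + 2 * l * cos s.
Definition width (l s : R) : R := sqrt (l ^ 2 + (2 + l * cos s) ^ 2).
Definition height (l s : R) : R := - (l * sin s * width l s) / 4.
(** What remains of the rate of the polar angle once the derivative of the half arctangent in
    [angle] is removed. It is nonnegative, whereas the full rate changes sign when [l] is
    positive. *)
Definition twist (l s : R) : R :=
  l ^ 2 * sin s ^ 2 * width l s / (rad l (level l s) * level l s).
(* The polar angle is split so that its secular part has a positive rate. *)
Definition angle (l s : R) : R :=
  / 2 * atan (4 * height l s / rad l (level l s)) + RInt (twist l) 0 s.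
Definition clock_rate (l m s : R) : R := level l s / (m * width l s).

Lemma rad_slope_level (l s : R) : rad_slope l (level l s) = 1 + l * cos s.
Proof. unfold rad_slope, level; field. Qed.

(** Completing the square gives [(l + cos s) ^ 2 + 1 + sin s ^ 2]. *)
Lemma level_ge_1 (l s : R) : 1 <= level l s.
Proof.
unfold level; pose proof (sin2_cos2 s) as E; unfold Rsqr in E.
pose proof (pow2_ge_0 (l + cos s)); nra.
Qed.

Lemma width_sq_pos (l s : R) : 0 < l ^ 2 + (2 + l * cos s) ^ 2.
Proof.
pose proof (pow2_ge_0 (2 + l * cos s)).
destruct (Req_dec l 0) as [->|Hl]; [nra|]. pose proof (pow2_gt_0 l Hl); lra.
Qed.

Lemma width_sq (l s : R) : width l s ^ 2 = l ^ 2 + (2 + l * cos s) ^ 2.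
Proof. unfold width; apply pow2_sqrt, Rlt_le, width_sq_pos. Qed.

Lemma width_pos (l s : R) : 0 < width l s.
Proof. apply sqrt_lt_R0, width_sq_pos. Qed.

Lemma level_sub_rad (l s : R) : level l s - rad l (level l s) = l ^ 2 * sin s ^ 2.
Proof.
unfold rad; rewrite rad_slope_level; unfold level.
rewrite <- !Rsqr_pow2, sin2, !Rsqr_pow2; ring.
Qed.

Lemma level_add_rad (l s : R) : level l s + rad l (level l s) = width l s ^ 2.
Proof. unfold rad; rewrite rad_slope_level, width_sq; unfold level; ring. Qed.

Lemma height_sq (l s : R) : rad l (level l s) ^ 2 + 16 * height l s ^ 2 = level l s ^ 2.
Proof.
replace (16 * height l s ^ 2) with (l ^ 2 * sin s ^ 2 * width l s ^ 2)
  by (unfold height; field).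
rewrite <- level_sub_rad, <- level_add_rad; ring.
Qed.

(** Here and in [is_derive_height], the derivative is written so that division by [clock_rate]
    yields the equation for [rho] or [z] in [reduced_curve_solution]. *)
Lemma is_derive_level (l s : R) : is_derive (level l) s (8 * height l s / width l s).
Proof.
pose proof (width_pos l s).
unfold level; auto_derive; [exact I|unfold height; field; lra].
Qed.

Lemma is_derive_height (l s : R) :
  is_derive (height l) s
    ((level l s - rad l (level l s) * rad_slope l (level l s)) / (2 * width l s)).
Proof.
pose proof (width_pos l s) as Hw; pose proof (width_sq_pos l s) as Hp.
unfold height, width; auto_derive.
- cbn [pow] in Hp; exact Hp.
- replace (l * (l * 1) + (2 + l * cos s) * ((2 + l * cos s) * 1))
    with (l ^ 2 + (2 + l * cos s) ^ 2) by ring.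
  change (sqrt _) with (width l s) in *.
  (* Clearing the denominator leaves only the square of [width], which is polynomial in [l] and
     [cos s]. *)
  apply (Rmult_eq_reg_l (4 * width l s)); [|lra].
  transitivity (2 * (level l s - rad l (level l s) * rad_slope l (level l s))).
  2: field; lra.
  transitivity (- (l * cos s * width l s ^ 2) + l ^ 2 * sin s ^ 2 * (2 + l * cos s)).
  + field; lra.
  + rewrite <- level_sub_rad, <- level_add_rad; unfold rad; rewrite rad_slope_level; unfold level.
    ring.
Qed.

Lemma is_derive_rad_level (l s : R) :
  is_derive (fun s => rad l (level l s)) s
    (8 * rad_slope l (level l s) * height l s / width l s).
Proof.
pose proof (is_derive_level l s) as D.
assert (E : Derive (fun u : R => level l u) s = 8 * height l s / width l s)
  by (apply is_derive_unique, D).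
pose proof (width_pos l s).
unfold rad, rad_slope; auto_derive; [eexists; exact D|].
rewrite E; field; lra.
Qed.

Lemma continuity_2d_level (l s : R) : continuity_2d_pt level l s.
Proof.
unfold level.
repeat first [apply continuity_2d_pt_plus | apply continuity_2d_pt_mult
  | apply continuity_2d_pt_id1 | apply continuity_2d_pt_const | apply (continuity_1d_2d_pt_comp cos)
  | apply continuity_2d_pt_id2 | apply continuity_cos ].
Qed.

Lemma continuity_2d_width (l s : R) : continuity_2d_pt width l s.
Proof.
unfold width; apply (continuity_1d_2d_pt_comp sqrt).
- apply continuity_pt_sqrt, Rlt_le, width_sq_pos.
- repeat first [apply continuity_2d_pt_plus | apply continuity_2d_pt_mult
  | apply continuity_2d_pt_id1 | apply continuity_2d_pt_const | apply (continuity_1d_2d_pt_comp cos)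
  | apply continuity_2d_pt_id2 | apply continuity_cos ].
Qed.

Lemma continuity_2d_twist (l s : R) : continuity_2d_pt twist l s.
Proof.
pose proof (level_ge_1 l s); pose proof (rad_pos l (level l s)).
unfold twist, Rdiv; apply continuity_2d_pt_mult; [|apply continuity_2d_pt_inv; [|nra]];
unfold rad, rad_slope;
repeat first [apply continuity_2d_level | apply continuity_2d_width
  | apply continuity_2d_pt_plus | apply continuity_2d_pt_opp | apply continuity_2d_pt_mult
  | apply continuity_2d_pt_id1 | apply continuity_2d_pt_const | apply (continuity_1d_2d_pt_comp sin)
  | apply continuity_2d_pt_id2 | apply continuity_sin ].
Qed.

Lemma continuous_twist (l s : R) : continuous (twist l) s.
Proof. apply continuity_2d_pt_continuous, continuity_2d_twist. Qed.

Lemma is_derive_angle (l s : R) :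
  is_derive (angle l) s
    ((level l s / rad l (level l s) - rad_slope l (level l s)) / width l s).
Proof.
pose proof (is_derive_height l s) as Dh; pose proof (is_derive_rad_level l s) as Dr.
pose proof (level_ge_1 l s); pose proof (rad_pos l (level l s)); pose proof (width_pos l s).
pose proof (height_sq l s) as Eh.
unfold angle; evar_last.
{ apply @is_derive_plus; [|apply is_derive_primitive, continuous_twist].
  apply is_derive_scal, (is_derive_comp atan); [apply is_derive_atan|].
  apply (is_derive_div (fun s => 4 * height l s) (fun s => rad l (level l s)));
    [apply is_derive_scal, Dh|exact Dr|lra]. }
unfold plus, scal; cbn -[pow]; unfold mult; cbn -[pow]; unfold twist, Rsqr.
rewrite <- level_sub_rad.
set (D := rad l (level l s)) in *; set (N := level l s) in *; set (W := width l s) in *.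
set (h := rad_slope l N) in *; set (z := height l s) in *.
replace (/ (1 + 4 * z / D * (4 * z / D))) with (D ^ 2 / N ^ 2).
2: rewrite <- Eh; field; split; [lra|pose proof (pow2_ge_0 (4 * z)); nra].
(* The first summand comes from the half arctangent, the second from [twist]. Since
   [16 * z ^ 2 = N ^ 2 - D ^ 2] and [W ^ 2 = N + D], they become [(D - N * h) / (W * N)] and
   [(N ^ 2 - D ^ 2) / (W * D * N)]. *)
transitivity (((N - D * h) * D - 16 * z ^ 2 * h) / (W * N ^ 2) + (N - D) * W ^ 2 / (W * D * N)).
{ field; lra. }
replace (16 * z ^ 2) with (N ^ 2 - D ^ 2) by lra.
replace (W ^ 2) with (N + D) by apply level_add_rad.
field; lra.
Qed.

Lemma clock_rate_pos (l m s : R) : 0 < m -> 0 < clock_rate l m s.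
Proof.
intros Hm; pose proof (level_ge_1 l s); pose proof (width_pos l s).
apply Rdiv_lt_0_compat; [lra|]; apply Rmult_lt_0_compat; lra.
Qed.

Lemma continuous_clock_rate (l m s : R) : 0 < m -> continuous (clock_rate l m) s.
Proof.
intros Hm; apply (continuity_2d_pt_continuous (fun l => clock_rate l m)).
pose proof (width_pos l s).
unfold clock_rate, Rdiv; apply continuity_2d_pt_mult; [apply continuity_2d_level|].
apply continuity_2d_pt_inv; [|nra].
apply continuity_2d_pt_mult; [apply continuity_2d_pt_const|apply continuity_2d_width].
Qed.

(** Supplies the expansion constant for [inverse_of_expanding]: [level] is at least [1] and [width]
    at most [2 * Rabs l + 3]. *)
Lemma clock_rate_lower_bound (l m s : R) : 0 < m -> / (m * (2 * Rabs l + 3)) <= clock_rate l m s.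
Proof.
intros Hm; pose proof (level_ge_1 l s); pose proof (width_pos l s).
pose proof (Rabs_pos l).
assert (Hw : width l s <= 2 * Rabs l + 3).
{ apply Rsqr_incr_0_var; [|lra]; rewrite !Rsqr_pow2, width_sq.
  pose proof (COS_bound s).
  assert (- Rabs l <= l * cos s <= Rabs l).
  { apply Rabs_le_between; rewrite Rabs_mult.
    assert (Rabs (cos s) <= 1) by (apply Rabs_le; lra). nra. }
  rewrite <- (pow2_abs l).
  nra. }
unfold clock_rate; rewrite <- (Rmult_1_l (/ _)).
apply Rmult_le_compat; [lra| |lra|].
- left; apply Rinv_0_lt_compat; nra.
- apply Rinv_le_contravar; nra.
Qed.

(** * The angle turned in one oscillation *)

Definition total_twist (l : R) : R := RInt (twist l) 0 (2 * PI).

Lemma total_twist_0 : total_twist 0 = 0.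
Proof.
unfold total_twist; rewrite (RInt_ext _ (fun _ => 0)).
- rewrite RInt_const; apply Rmult_0_r.
- intros s _; change (twist 0 s = 0); unfold twist, Rdiv; ring.
Qed.

Lemma total_twist_1_pos : 0 < total_twist 1.
Proof.
pose proof PI_RGT_0; unfold total_twist.
assert (Hex := fun a b => continuous_ex_RInt _ a b (continuous_twist 1)).
assert (Hpos : forall s, sin s <> 0 -> 0 < twist 1 s).
{ intros s Hs; pose proof (level_ge_1 1 s); pose proof (rad_pos 1 (level 1 s)).
  pose proof (width_pos 1 s); pose proof (pow2_gt_0 _ Hs).
  unfold twist; apply Rdiv_lt_0_compat; [rewrite pow1, Rmult_1_l|]; apply Rmult_lt_0_compat; lra. }
(* The integrand vanishes at [PI], so strict positivity is used on the two open halves. *)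
rewrite <- (RInt_Chasles (twist 1) 0 PI (2 * PI)) by apply Hex.
apply Rplus_lt_0_compat; (apply RInt_gt_0; [lra| |intros; apply continuous_twist]).
- intros s Hs; apply Hpos; pose proof (sin_gt_0 s); lra.
- intros s Hs; apply Hpos; pose proof (sin_lt_0 s); lra.
Qed.

Lemma total_twist_value (y : R) : 0 < y <= total_twist 1 -> exists l, 0 < l <= 1 /\ total_twist l = y.
Proof.
intros Hy; pose proof PI_RGT_0.
destruct (IVT_gen_consistent total_twist 0 1 y) as (l & Hl & El).
- apply continuous_RInt_param; [lra|apply continuity_2d_twist].
- rewrite total_twist_0, Rmin_left, Rmax_right; lra.
- rewrite Rmin_left, Rmax_right in Hl by lra.
  exists l; split; [|exact El].
  destruct Hl as [[Hl|<-] Hl1]; [lra|rewrite total_twist_0 in El; lra].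
Qed.

Lemma level_periodic (l s : R) (n : nat) : level l (s + INR n * (2 * PI)) = level l s.
Proof.
unfold level; replace (s + INR n * (2 * PI)) with (s + 2 * INR n * PI) by ring.
rewrite cos_period; reflexivity.
Qed.

Lemma width_periodic (l s : R) (n : nat) : width l (s + INR n * (2 * PI)) = width l s.
Proof.
unfold width; replace (s + INR n * (2 * PI)) with (s + 2 * INR n * PI) by ring.
rewrite cos_period; reflexivity.
Qed.

Lemma height_periodic (l s : R) (n : nat) : height l (s + INR n * (2 * PI)) = height l s.
Proof.
unfold height; rewrite width_periodic.
replace (s + INR n * (2 * PI)) with (s + 2 * INR n * PI) by ring.
rewrite sin_period; reflexivity.
Qed.

(** The arctangent term has period [2 * PI]; only the integral accumulates. *)
Lemma angle_shift (l s : R) (n : nat) :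
  angle l (s + INR n * (2 * PI)) = angle l s + INR n * total_twist l.
Proof.
unfold angle; rewrite height_periodic, level_periodic, RInt_periodic.
- unfold total_twist; symmetry; apply Rplus_assoc.
- apply continuous_twist.
- intros u; unfold twist.
  replace (u + 2 * PI) with (u + INR 1 * (2 * PI)) by (cbn; ring).
  rewrite level_periodic, width_periodic.
  replace (u + INR 1 * (2 * PI)) with (u + 2 * INR 1 * PI) by ring.
  rewrite sin_period; reflexivity.
Qed.

(** * The periodic solutions *)

Definition flower (l m : R) (psi : R -> R) : phase_curve :=
  let r t := sqrt (rad l (level l (psi t))) in
  reduced_curve l m (fun t => level l (psi t))
    (fun t => r t * cos (angle l (psi t)))
    (fun t => r t * sin (angle l (psi t)))
    (fun t => height l (psi t)).

(** Treats both coordinates at once: [u], [v] are [cos], [sin] for [x], and [sin], [- cos] for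
    [y]. *)
Lemma is_derive_polar_coordinate (l s : R) (u v : R -> R) :
  is_derive u (angle l s) (- v (angle l s)) ->
  is_derive (fun s => sqrt (rad l (level l s)) * u (angle l s)) s
    (4 * rad_slope l (level l s) * height l s
       * (sqrt (rad l (level l s)) * u (angle l s)) / rad l (level l s) / width l s
     - (level l s / rad l (level l s) - rad_slope l (level l s)) / width l s
       * (sqrt (rad l (level l s)) * v (angle l s))).
Proof.
intros Du.
pose proof (rad_pos l (level l s)) as Hr; pose proof (width_pos l s).
pose proof (sqrt_lt_R0 _ Hr).
evar_last.
{ apply @is_derive_mult; [| |intros; apply Rmult_comm].
  - apply is_derive_sqrt; [apply is_derive_rad_level|exact Hr].
  - apply (is_derive_comp u); [exact Du|apply is_derive_angle]. }
unfold plus, mult, scal; cbn -[pow]; unfold mult; cbn -[pow].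
replace (4 * rad_slope l (level l s) * height l s
       * (sqrt (rad l (level l s)) * u (angle l s)) / rad l (level l s) / width l s)
  with (4 * rad_slope l (level l s) * height l s * u (angle l s) / sqrt (rad l (level l s)) / width l s).
- field; lra.
- rewrite <- (sqrt_sqrt (rad l (level l s))) at 3 by lra; field; lra.
Qed.

Lemma flower_solution (l m : R) (psi : R -> R) :
  0 < m -> 4 * PI * l ^ 2 * m ^ 2 = 1 ->
  (forall t, is_derive psi t (/ clock_rate l m (psi t))) ->
  hamilton_solution (flower l m psi).
Proof.
intros Hm Em Dpsi.
assert (Hcomp : forall F t F' G', is_derive F (psi t) F' -> / clock_rate l m (psi t) * F' = G' ->
  is_derive (fun t => F (psi t)) t G').
{ intros F t F' G' DF <-; apply (is_derive_comp F psi); [exact DF|apply Dpsi]. }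
apply reduced_curve_solution; [exact Em| | | | | | |]; intros t;
  pose proof (level_ge_1 l (psi t)); pose proof (width_pos l (psi t));
  pose proof (rad_pos l (level l (psi t))).
- lra.
- pose proof (sin2_cos2 (angle l (psi t))) as E; unfold Rsqr in E.
  rewrite !Rpow_mult_distr, pow2_sqrt by lra; nra.
- apply height_sq.
- apply Hcomp with (1 := is_derive_level l (psi t)); unfold clock_rate; field; lra.
- apply Hcomp with (1 := is_derive_height l (psi t)); unfold clock_rate; field; lra.
- eapply (Hcomp (fun s => sqrt (rad l (level l s)) * cos (angle l s))).
  + apply (is_derive_polar_coordinate l (psi t) cos sin); apply is_derive_cos.
  + unfold clock_rate; field; lra.
- eapply (Hcomp (fun s => sqrt (rad l (level l s)) * sin (angle l s))).
  + apply (is_derive_polar_coordinate l (psi t) sin (fun a => - cos a)).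
    rewrite Ropp_involutive; apply is_derive_sin.
  + unfold clock_rate; field; lra.
Qed.

(** The orbit even avoids the whole [z]-axis, because [rad] is positive. *)
Lemma flower_collision_free (l m : R) (psi : R -> R) : collision_free (flower l m psi).
Proof.
intros t (Hx & Hy & _); cbn in Hx, Hy.
pose proof (sqrt_lt_R0 _ (rad_pos l (level l (psi t)))).
pose proof (sin2_cos2 (angle l (psi t))) as E; unfold Rsqr in E; nra.
Qed.

Lemma flower_rotation (l m T a : R) (psi : R -> R) (N : nat) :
  (forall t, psi (t + T) = psi t + INR N * (2 * PI)) -> INR N * total_twist l = a ->
  forall t,
    cx (flower l m psi) (t + T)
      = cos a * cx (flower l m psi) t - sin a * cy (flower l m psi) t /\
    cy (flower l m psi) (t + T)
      = sin a * cx (flower l m psi) t + cos a * cy (flower l m psi) t.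
Proof.
intros Hpsi Ea t; cbn -[pow].
rewrite !Hpsi, !angle_shift, !level_periodic, Ea, cos_plus, sin_plus; split; ring.
Qed.

Lemma flower_period (l m T : R) (psi : R -> R) (N q : nat) :
  (forall t, psi (t + T) = psi t + INR N * (2 * PI)) ->
  INR N * total_twist l = INR q * (2 * PI) ->
  has_period (flower l m psi) T.
Proof.
intros Hpsi Eq t; cbn -[pow].
rewrite !Hpsi, !angle_shift, !height_periodic, !level_periodic, Eq.
replace (angle l (psi t) + INR q * (2 * PI)) with (angle l (psi t) + 2 * INR q * PI) by ring.
rewrite cos_period, sin_period; repeat split; reflexivity.
Qed.

(* The momentum [cpz] alone recovers [level], hence [psi] modulo a full turn. *)
Lemma flower_period_inv (l m T : R) (psi : R -> R) :
  0 < l -> 0 < m -> psi 0 = 0 -> 0 <= psi T -> 0 < total_twist l ->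
  has_period (flower l m psi) T ->
  exists N q : nat, psi T = INR N * (2 * PI) /\ INR N * total_twist l = INR q * (2 * PI).
Proof.
intros Hl Hm H0 HT Htw Hper.
destruct (Hper 0) as (Ex & _ & _ & _ & _ & Epz); cbn -[pow] in Ex, Epz.
rewrite Rplus_0_l, H0 in *.
assert (El : level l (psi T) = level l 0).
{ apply Rmult_eq_reg_l in Epz; [|lra].
  assert (E : l ^ 2 * / level l (psi T) = l ^ 2 * / level l 0) by (unfold Rdiv in Epz; lra).
  apply Rmult_eq_reg_l, Rinv_eq_reg in E; [exact E|]. apply pow_nonzero; lra. }
assert (Hcos : cos (psi T) = 1) by (unfold level in El; rewrite cos_0 in El; nra).
destruct (cos_eq_1_nat _ HT Hcos) as (N & EN); exists N.
rewrite EN in Ex.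
replace (INR N * (2 * PI)) with (0 + INR N * (2 * PI)) in Ex by ring.
rewrite level_periodic, angle_shift in Ex.
assert (Ea : angle l 0 = 0).
{ unfold angle, height; rewrite RInt_point, sin_0.
  replace (4 * (- (l * 0 * width l 0) / 4) / rad l (level l 0)) with 0 by (unfold Rdiv; ring).
  rewrite atan_0; change (/ 2 * 0 + 0 = 0); ring. }
(* The planet starts at polar angle zero, so equality of the [x] coordinates alone says that the
   accumulated twist has cosine [1]. *)
rewrite Ea, cos_0, Rplus_0_l in Ex.
apply Rmult_eq_reg_l in Ex; [|apply Rgt_not_eq, sqrt_lt_R0, rad_pos].
destruct (cos_eq_1_nat (INR N * total_twist l)) as (q & Eq); [|exact Ex|exists q; auto].
apply Rmult_le_pos; [apply pos_INR|lra].
Qed.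

(** * Arithmetic of the rotation number and conclusion *)

Lemma coprime_small_fraction (j k : nat) (eps : R) :
  (0 < j)%nat -> (0 < k)%nat -> Nat.gcd j k = 1%nat -> 0 < eps ->
  exists n : nat, (0 < n)%nat /\ Nat.gcd j (k * n) = 1%nat /\ INR j / INR (k * n) <= eps.
Proof.
intros Hj Hk Hgcd Heps.
destruct (INR_unbounded (/ eps)) as (q & Hq).
(* A number of this form is coprime to [j] for every [q], and it exceeds [q * j], so the fraction is
   below [/ q], itself below [eps]. *)
exists (1 + q * j)%nat; split; [lia|split].
- set (d := Nat.gcd j (k * (1 + q * j))).
  assert (Hdj : Nat.divide d j) by apply Nat.gcd_divide_l.
  assert (Hdn : Nat.divide d (1 + q * j)).
  { apply (Nat.gauss _ k); [apply Nat.gcd_divide_r|].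
    apply Nat.divide_1_r; rewrite <- Hgcd; apply Nat.gcd_greatest; [|apply Nat.gcd_divide_r].
    apply (Nat.divide_trans _ d); [apply Nat.gcd_divide_l|exact Hdj]. }
  apply Nat.divide_1_r, (Nat.divide_add_cancel_r d (q * j)); [apply Nat.divide_mul_r, Hdj|].
  rewrite Nat.add_comm; exact Hdn.
- assert (Hq0 : 0 < INR q) by (pose proof (Rinv_0_lt_compat _ Heps); lra).
  assert (Hj' : 0 < INR j) by (apply lt_0_INR, Hj).
  assert (Hqj : INR q * INR j <= INR (k * (1 + q * j))).
  { rewrite <- mult_INR; apply le_INR; nia. }
  assert (1 <= eps * INR q).
  { replace 1 with (eps * / eps) by (field; lra); apply Rmult_le_compat_l; lra. }
  apply Rle_div_l; nra.
Qed.

Theorem mainTheorem7 (j k : nat) :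
  (0 < j)%nat -> (j <= k)%nat -> Nat.gcd j k = 1%nat ->
  exists (c : phase_curve) (T : R),
    periodic_solution c T /\ rotation_number c T j k.
Proof.
intros Hj Hjk Hgcd; pose proof PI_RGT_0 as Hpi.
assert (Hk : (0 < k)%nat) by lia.
assert (Heps : 0 < total_twist 1 / (2 * PI)) by (apply Rdiv_lt_0_compat; [apply total_twist_1_pos|lra]).
destruct (coprime_small_fraction j k _ Hj Hk Hgcd Heps) as (n & Hn & Hcop & Hle).
assert (Hj' := lt_0_INR _ Hj); assert (Hk' := lt_0_INR _ Hk); assert (Hn' := lt_0_INR _ Hn).
assert (Hkn : 0 < INR (k * n)) by (rewrite mult_INR; nra).
destruct (total_twist_value (INR j / INR (k * n) * (2 * PI))) as (l & Hl & El).
{ split; [apply Rmult_lt_0_compat; [apply Rdiv_lt_0_compat|]; lra|].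
  apply Rle_div_r in Hle; lra. }
(* The positive root of the zero-energy condition [4 * PI * l ^ 2 * m ^ 2 = 1]. *)
set (m := / (2 * l * sqrt PI)).
assert (Hsq := sqrt_lt_R0 PI Hpi).
assert (Hm : 0 < m) by (apply Rinv_0_lt_compat; nra).
assert (Em : 4 * PI * l ^ 2 * m ^ 2 = 1).
{ unfold m; rewrite <- (sqrt_sqrt PI) at 1 by lra; field; lra. }
(* Time as a function of the oscillation parameter; its inverse [psi] puts the orbit in physical
   time, and [P] below is the duration of one oscillation. *)
set (clock s := RInt (clock_rate l m) 0 s).
assert (Hcont : forall s, continuous (clock_rate l m) s) by (intros; apply continuous_clock_rate, Hm).
destruct (inverse_of_expanding clock (clock_rate l m) (/ (m * (2 * Rabs l + 3))))
  as (psi & clockK & psiK & Dpsi).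
{ apply Rinv_0_lt_compat; pose proof (Rabs_pos l); nra. }
{ intros s; apply is_derive_primitive, Hcont. }
{ intros s; apply clock_rate_lower_bound, Hm. }
set (P := clock (2 * PI)).
assert (Hclock : forall s N, clock (s + INR N * (2 * PI)) = clock s + INR N * P).
{ intros s N; apply RInt_periodic; [exact Hcont|].
  intros u; unfold clock_rate.
  replace (u + 2 * PI) with (u + INR 1 * (2 * PI)) by (cbn; ring).
  rewrite level_periodic, width_periodic; reflexivity. }
assert (Hpsi : forall N t, psi (t + INR N * P) = psi t + INR N * (2 * PI)).
{ intros N t; rewrite <- (clockK t) at 1; rewrite <- Hclock; apply psiK. }
assert (H0 : clock 0 = 0) by apply (RInt_point 0 (clock_rate l m)).
assert (Hpsi0 : psi 0 = 0) by (rewrite <- H0 at 1; apply psiK).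
assert (Hmono : forall a b, a <= b -> psi a <= psi b).
{ intros a b Hab.
  pose proof (derive_ge_increment psi (fun t => / clock_rate l m (psi t)) 0 a b Dpsi).
  assert (0 * (b - a) <= psi b - psi a); [apply H; [|exact Hab]|lra].
  intros s; left; apply Rinv_0_lt_compat, clock_rate_pos, Hm. }
assert (HP : 0 < P).
(* Otherwise monotonicity of [psi] would give [2 * PI <= 0]. *)
{ apply Rnot_le_lt; intros HP; apply Hmono in HP.
  unfold P in HP; rewrite psiK, Hpsi0 in HP; lra. }
assert (Ekn : INR (k * n) * total_twist l = INR j * (2 * PI)) by (rewrite El; field; lra).
exists (flower l m psi), (INR (k * n) * P); split; [split; [|split; [|split; [|split]]]|].
- apply flower_solution; assumption.
- apply flower_collision_free.
- nra.
- apply flower_period with (1 := Hpsi _) (2 := Ekn).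
(* A smaller period would consist of [N] oscillations and [q] full turns, whence
   [j * N = k * n * q]. Coprimality then makes [k * n] divide the positive number [N], contradicting
   [T' < INR (k * n) * P]. *)
- intros T' HT' Hper.
  destruct (flower_period_inv l m T' psi) as (N & q & EN & Eq); try lra; try assumption.
  { rewrite <- Hpsi0; apply Hmono; lra. }
  { rewrite El; apply Rmult_lt_0_compat; [apply Rdiv_lt_0_compat|]; lra. }
  assert (ET : T' = INR N * P).
  { rewrite <- (clockK T'), EN, <- (Rplus_0_l (INR N * (2 * PI))), Hclock, H0; ring. }
  assert (Enat : (j * N = k * n * q)%nat).
  { apply INR_eq; rewrite !mult_INR in *.
    apply (Rmult_eq_reg_r (2 * PI)); [|lra].
    transitivity (INR N * (INR j * (2 * PI))); [ring|].
    rewrite <- Ekn; transitivity (INR k * INR n * (INR N * total_twist l)); [ring|].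
    rewrite Eq; ring. }
  assert (Hdiv : Nat.divide (k * n) N).
  { apply (Nat.gauss _ j); [exists q; lia|rewrite Nat.gcd_comm; exact Hcop]. }
  assert (HN : (0 < N)%nat) by (apply INR_lt; cbn; nra).
  apply Nat.divide_pos_le in Hdiv; [|exact HN].
  apply le_INR in Hdiv; nra.
(* One [k]-th of the period is exactly [n] oscillations. *)
- intros t; apply flower_rotation with (N := n).
  + replace (INR (k * n) * P / INR k) with (INR n * P) by (rewrite mult_INR; field; lra).
    apply Hpsi.
  + rewrite mult_INR in Ekn.
    apply (Rmult_eq_reg_l (INR k)); [|lra].
    transitivity (INR j * (2 * PI)); [lra|field; lra].
Qed.
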